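(* Let $\vec\beta=(\beta_{a,x})_{a\in\mathbb Z_d^n,x\in\mathbb Z_2^n}$ be an $(n,2,d)$ Bell functional and let $\tilde a$ be a local deterministic strategy with correlation $p_{\tilde a}$. For $S\subseteq\{1,\dots,n\}$, the family $\vec\beta^S=(\beta^S_{\alpha,\xi})$ defined in the context defines, up to relabeling of the output strings, a $(|S|,2,d-1)$ Bell functional, to which one associates a Bell operator $\mathcal B^S$ (called a ''subset game''). Let $\Sigma=(\rho,\Pi)$ be a quantum projective strategy of local dimension $d$ such that $\mathcal P(\Sigma)=p_{\tilde a}$. Then $\mathcal B_2(\Pi)$ admits a direct sum decomposition into subset games (up to a permutation of the tensor factors, so that each local operator acts on its own party): $$\mathcal B_2(\Pi)=\sum_{\substack{S\subseteq\{1,\dots,n\}\\|S|\ge2}} I_S\otimes\mathcal B^S(\Pi^S),$$ where $I_S=\bigotimes_{j\notin S}\Pi^{(j)}_{\tilde a_j(0)|0}$ is the projector used by the parties that are inactive for the subset $S$, and, for $S=\{s_1,\dots,s_{|S|}\}$, $\Pi^S=(\Pi^{(s_1)},\dots,\Pi^{(s_{|S|})})$ is the measurement strategy of the parties in $S$.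
   Context: A Bell functional in the $(n,2,d)$ scenario ($n$ parties, inputs in $\mathbb Z_2$, outputs in $\mathbb Z_d$) is a family of real coefficients $\beta_{a,x}$, $a\in\mathbb Z_d^n$, $x\in\mathbb Z_2^n$, acting on correlations $p\in\mathbb R^{d^n\times 2^n}$ by $\vec\beta\cdot p=\sum_{a,x}\beta_{a,x}p(a|x)$. A local deterministic strategy is a family $\tilde a=(\tilde a_i:\mathbb Z_2\to\mathbb Z_d)_{1\le i\le n}$; write $\tilde a(x)=\tilde a_1(x_1)\dots\tilde a_n(x_n)$. Its correlation is $p_{\tilde a}(a|x)=\prod_i\delta_{a_i,\tilde a_i(x_i)}$. A quantum projective strategy of local dimension $d$ is a pair $\Sigma=(\rho,\Pi)$ with $\rho$ a density operator on $(\mathbb C^d)^{\otimes n}$ and, for every party $i$ and input $x_i\in\mathbb Z_2$, a projective measurement $(\Pi^{(i)}_{a_i|x_i})_{a_i\in\mathbb Z_d}$ on $\mathbb C^d$, i.e. projectors with $\Pi^{(i)}_{a_i|x_i}\Pi^{(i)}_{a_i'|x_i}=0$ for $a_i\ne a_i'$ and summing to the identity. With $\Pi_{a|x}=\Pi^{(1)}_{a_1|x_1}\otimes\cdots\otimes\Pi^{(n)}_{a_n|x_n}$, it realizes the correlation $\mathcal P(\Sigma)(a|x)=\mathrm{Tr}(\rho\,\Pi_{a|x})$. For $c\in\mathbb Z_d^n$, $w(c)=|\{i: c_i\ne0\}|$. Define $$\mathcal B_2(\Pi)=\sum_{x\in\mathbb Z_2^n}\ \sum_{a\in\mathbb Z_d^n:\,w(a-\tilde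 a(x))\ge2}(\beta_{a,x}-\beta_{\tilde a(x),x})\,\Pi_{a|x}.$$ For $S=\{s_1,\dots,s_r\}\subseteq\{1,\dots,n\}$ and a string $c$ of length $n$, $c_S=c_{s_1}\dots c_{s_r}$. For $x\in\mathbb Z_2^n$ let $\mathbb Z_d^{S,x}=\{\alpha\in\mathbb Z_d^{|S|}:\alpha_i\neq\tilde a_{s_i}(x_{s_i})\ \forall\,1\le i\le|S|\}$ (this depends on $x$ only through $x_S$). For $\alpha\in\mathbb Z_d^{S,x}$, $\alpha^{x,S}\in\mathbb Z_d^n$ is the unique string with $(\alpha^{x,S})_S=\alpha$ and $\alpha^{x,S}_j=\tilde a_j(x_j)$ for all $j\notin S$. For $\xi\in\mathbb Z_2^{|S|}$ and $\alpha\in\mathbb Z_d^{|S|}$ with $\alpha_i\ne\tilde a_{s_i}(\xi_i)$ for all $i$, define $$\beta^S_{\alpha,\xi}=\sum_{x\in\mathbb Z_2^n:\,x_S=\xi}\big(\beta_{\alpha^{x,S},x}-\beta_{\tilde a(x),x}\big).$$ The associated Bell operator is $\mathcal B^S(\Pi^S)=\sum_{\alpha,\xi}\beta^S_{\alpha,\xi}\,\Pi^{(s_1)}_{\alpha_1|\xi_1}\otimes\cdots\otimes\Pi^{(s_{|S|})}_{\alpha_{|S|}|\xi_{|S|}}$, the sum running over those $(\alpha,\xi)$ for which $\beta^S_{\alpha,\xi}$ is defined.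
   Formalization: The formal theorem additionally assumes that each projector onto a deterministic outcome, Π^{(i)}_{ã_i(z)|z}, has rank one; with degenerate projective measurements the stated identity can fail (e.g. n=3, d=2, Π^{(3)}_{0|0}=I). *)

(* Defs.v *)
(* R is a real closed field; R[i] is the field of complex numbers when R is
   the field of real numbers. *)
From HB Require Import structures.
From mathcomp Require Import all_boot all_order all_algebra.
From mathcomp Require Import complex.

Set Implicit Arguments.
Unset Strict Implicit.
Unset Printing Implicit Defensive.

Import Order.TTheory GRing.Theory Num.Theory.
Local Open Scope ring_scope.
Local Open Scope complex_scope.
Local Open Scope sesquilinear_scope.

Section Scenario.
Variables (R : rcfType) (n k : nat).

(* A string a_1 ... a_n is a finite function on 'I_n.  The k outputs are
   'I_k, which for k = m.+1 carry the additive group structure of Z_k. *)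
Definition bell_functional : Type :=
  {ffun 'I_n -> 'I_k} -> {ffun 'I_n -> 'Z_2} -> R.

Definition det_strategy : Type := 'I_n -> 'Z_2 -> 'I_k.

Definition det_output (adet : det_strategy) (x : {ffun 'I_n -> 'Z_2}) :
  {ffun 'I_n -> 'I_k} := [ffun i => adet i (x i)].

Definition det_correlation (adet : det_strategy)
  (a : {ffun 'I_n -> 'I_k}) (x : {ffun 'I_n -> 'Z_2}) : R :=
  \prod_(i < n) (a i == adet i (x i))%:R.

End Scenario.

Definition weight (n m : nat) (c : {ffun 'I_n -> 'I_m.+1}) : nat :=
  #|[set i | c i != 0]|.

Section Operators.
Variable R : rcfType.
Local Notation C := R[i].

(* Operators on the n-fold tensor power of C^d are matrices in the product
   basis, which is indexed by the strings {ffun 'I_n -> 'I_d}. *)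
Definition tdim (n d : nat) : nat := #|{ffun 'I_n -> 'I_d}|.

Definition basis_string (n d : nat) (u : 'I_(tdim n d)) :
  {ffun 'I_n -> 'I_d} := enum_val u.

Definition basis_index (n d : nat) (f : {ffun 'I_n -> 'I_d}) :
  'I_(tdim n d) := enum_rank f.

Definition tensor (n d : nat) (A : 'I_n -> 'M[C]_d) : 'M[C]_(tdim n d) :=
  \matrix_(u, v) \prod_(i < n) A i (basis_string u i) (basis_string v i).

Definition projector (N : nat) (P : 'M[C]_N) : Prop :=
  P *m P = P /\ P ^t* = P.

Definition density (N : nat) (rho : 'M[C]_N) : Prop :=
  [/\ rho ^t* = rho,
      forall v : 'cV[C]_N, 0 <= (v ^t* *m rho *m v) 0 0
    & \tr rho = 1].

Definition projective_measurement (k d : nat) (P : 'I_k -> 'M[C]_d) : Prop :=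
  [/\ forall a, projector (P a),
      forall a a', a != a' -> P a *m P a' = 0
    & \sum_(a < k) P a = 1%:M].

(* Local operators indexed by party, input and output. *)
Definition local_operators (n k d : nat) : Type :=
  'I_n -> 'Z_2 -> 'I_k -> 'M[C]_d.

Definition joint_operator (n k d : nat) (Pi : local_operators n k d)
  (a : {ffun 'I_n -> 'I_k}) (x : {ffun 'I_n -> 'Z_2}) : 'M[C]_(tdim n d) :=
  tensor (fun i => Pi i (x i) (a i)).

Definition bell_operator (n k d : nat) (beta : bell_functional R n k)
  (Pi : local_operators n k d) : 'M[C]_(tdim n d) :=
  \sum_x \sum_a (beta a x)%:C *: joint_operator Pi a x.

Record projective_strategy (n d : nat) := ProjectiveStrategy {
  state : 'M[C]_(tdim n d);
  meas : local_operators n d d;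
  state_density : density state;
  meas_projective : forall i z, projective_measurement (meas i z)
}.

Definition realizes (n d : nat) (Sigma : projective_strategy n d)
  (p : {ffun 'I_n -> 'I_d} -> {ffun 'I_n -> 'Z_2} -> R) : Prop :=
  forall a x, \tr (state Sigma *m joint_operator (meas Sigma) a x) = (p a x)%:C.

Definition B2 (n m d : nat) (beta : bell_functional R n m.+1)
  (adet : det_strategy n m.+1) (Pi : local_operators n m.+1 d) :
  'M[C]_(tdim n d) :=
  \sum_x \sum_(a : {ffun 'I_n -> 'I_m.+1} |
               (2 <= weight (a - det_output adet x)%R)%N)
    (beta a x - beta (det_output adet x) x)%:C *: joint_operator Pi a x.

(* A is the orthogonal direct sum of the B i: these live on mutually
   orthogonal subspaces, given by their projectors P i. *)
Definition direct_sum_decomposition (N : nat) (I : finType) (Q : pred I)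
  (A : 'M[C]_N) (B : I -> 'M[C]_N) : Prop :=
  A = \sum_(i | Q i) B i /\
  exists P : I -> 'M[C]_N,
    [/\ forall i, Q i -> projector (P i),
        forall i j, Q i -> Q j -> i != j -> P i *m P j = 0
      & forall i, Q i -> B i = P i *m B i *m P i].

End Operators.

(* For S = {s_1 < ... < s_r}, the element s_i is enum_val i, with i : 'I_#|S|. *)
Definition substring (n : nat) (S : {set 'I_n}) (T : Type)
  (c : {ffun 'I_n -> T}) : {ffun 'I_#|S| -> T} := [ffun i => c (enum_val i)].

Section Subsets.
Variables (n : nat) (S : {set 'I_n}).

Definition extend (k : nat) (adet : det_strategy n k)
  (alpha : {ffun 'I_#|S| -> 'I_k}) (x : {ffun 'I_n -> 'Z_2}) :
  {ffun 'I_n -> 'I_k} :=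
  [ffun j => if [pick i : 'I_#|S| | enum_val i == j] is Some i
             then alpha i else adet j (x j)].

Lemma substring_extend (k : nat) (adet : det_strategy n k) alpha x :
  substring S (extend adet alpha x) = alpha.
Proof.
apply/ffunP=> i; rewrite !ffunE.
case: pickP => [j /eqP /enum_val_inj -> //|/(_ i)]; by rewrite eqxx.
Qed.

Lemma extend_out (k : nat) (adet : det_strategy n k) alpha x j :
  j \notin S -> extend adet alpha x j = adet j (x j).
Proof.
move=> jNS; rewrite ffunE; case: pickP => [i /eqP eij|//].
by rewrite -eij enum_valP in jNS.
Qed.

Variable R : rcfType.
Local Notation C := R[i].

(* The condition on (alpha, xi) under which beta^S_(alpha, xi) is defined. *)
Definition admissible (k : nat) (adet : det_strategy n k)
  (alpha : {ffun 'I_#|S| -> 'I_k}) (xi : {ffun 'I_#|S| -> 'Z_2}) : bool :=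
  [forall i, alpha i != adet (enum_val i) (xi i)].

(* Only the values at admissible (alpha, xi) are meaningful. *)
Definition subset_coeff (k : nat) (beta : bell_functional R n k)
  (adet : det_strategy n k)
  (alpha : {ffun 'I_#|S| -> 'I_k}) (xi : {ffun 'I_#|S| -> 'Z_2}) : R :=
  \sum_(x | substring S x == xi)
    (beta (extend adet alpha x) x - beta (det_output adet x) x).

Definition subset_operator (k d : nat) (beta : bell_functional R n k)
  (adet : det_strategy n k) (Pi : local_operators R #|S| k d) :
  'M[C]_(tdim #|S| d) :=
  \sum_xi \sum_(alpha | admissible adet alpha xi)
    (subset_coeff beta adet alpha xi)%:C *: joint_operator Pi alpha xi.

(* gamma is the subset game with the k.+1 - 1 allowed outputs of each party,
   given its input, renamed by tau as 'I_k. *)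
Definition subset_game_relabeling (k : nat) (beta : bell_functional R n k.+1)
  (adet : det_strategy n k.+1) (gamma : bell_functional R #|S| k)
  (tau : 'I_#|S| -> 'Z_2 -> 'I_k -> 'I_k.+1) : Prop :=
  [/\ forall i z, injective (tau i z),
      forall i z b, (exists l, tau i z l = b) <-> b != adet (enum_val i) z,
      forall l xi,
        gamma l xi = subset_coeff beta adet [ffun i => tau i (xi i) (l i)] xi
    & forall d (Pi : local_operators R #|S| k.+1 d),
        subset_operator beta adet Pi =
        bell_operator gamma (fun i z l => Pi i z (tau i z l))].

Definition restrict_parties (k d : nat) (Pi : local_operators R n k d) :
  local_operators R #|S| k d := fun i => Pi (enum_val i).

(* A (x) B with the tensor factors permuted so that A acts on the parties
   outside S and B on the parties in S. *)
Definition tensor_split (d : nat) (A : 'M[C]_(tdim #|~: S| d))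
  (B : 'M[C]_(tdim #|S| d)) : 'M[C]_(tdim n d) :=
  \matrix_(u, v)
    (A (basis_index (substring (~: S) (basis_string u)))
       (basis_index (substring (~: S) (basis_string v))) *
     B (basis_index (substring S (basis_string u)))
       (basis_index (substring S (basis_string v)))).

Definition inactive_projector (k d : nat) (adet : det_strategy n k)
  (Pi : local_operators R n k d) : 'M[C]_(tdim #|~: S| d) :=
  tensor (fun i : 'I_#|~: S| => Pi (enum_val i) 0 (adet (enum_val i) 0)).

End Subsets.

Arguments subset_operator {n} S {R k d} beta adet Pi.
Arguments restrict_parties {n} S {R k d} Pi.
Arguments inactive_projector {n} S {R k d} adet Pi.

(* Main.v *)
(* Realizing p_adet exactly forces rho *m T x = rho for each deterministic
   projector T x, since rho is positive and tr(rho T x) = tr rho.  Comparing two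
   inputs that differ at one party only, and using rank one, the deterministic
   projector of each party does not depend on its input.  Grouping the terms
   (a, x) of B2 by the set S of parties whose output deviates from adet then
   gives the sum; the subspaces are cut out by the tensor products of p_i for
   i outside S and 1 - p_i for i in S, with p_i the deterministic projector. *)
Require Import Defs.
From HB Require Import structures.
From mathcomp Require Import all_boot all_order all_algebra.
From mathcomp Require Import complex ring.

Set Implicit Arguments.
Unset Strict Implicit.
Unset Printing Implicit Defensive.

Import Order.TTheory GRing.Theory Num.Theory.
Local Open Scope ring_scope.
Local Open Scope sesquilinear_scope.

(** * Adjoints and positive operators *)

Section Adjoint.
Variable C : numClosedFieldType.

Lemma adjmxM p q r (A : 'M[C]_(p, q)) (B : 'M[C]_(q, r)) :
  (A *m B)^t* = B^t* *m A^t*.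
Proof. by rewrite trmx_mul map_mxM. Qed.

Lemma adjmxK p q (A : 'M[C]_(p, q)) : A^t*^t* = A.
Proof. by apply/matrixP=> i j; rewrite !mxE conjCK. Qed.

Lemma adjmxMl_diagE p q (A : 'M[C]_(p, q)) j :
  (A^t* *m A) j j = \sum_i `|A i j| ^+ 2.
Proof. by rewrite mxE; apply: eq_bigr => i _; rewrite !mxE normCKC. Qed.

Lemma adjmxMl_diag_ge0 p q (A : 'M[C]_(p, q)) j : 0 <= (A^t* *m A) j j.
Proof. by rewrite adjmxMl_diagE sumr_ge0 // => i _; rewrite exprn_ge0. Qed.

Lemma adjmxMl_eq0 p q (A : 'M[C]_(p, q)) :
  (forall j, (A^t* *m A) j j = 0) -> A = 0.
Proof.
move=> A0; apply/matrixP=> i j; rewrite mxE; apply/eqP.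
have /eqP := A0 j; rewrite adjmxMl_diagE psumr_eq0 => [|k _]; last first.
  by rewrite exprn_ge0.
by move=> /allP/(_ i (mem_index_enum _)); rewrite /= expf_eq0 normr_eq0.
Qed.

Section Positive.
Variables (N : nat) (rho : 'M[C]_N).
Hypothesis rho_adj : rho^t* = rho.
Hypothesis rho_ge0 : forall v : 'cV[C]_N, 0 <= (v^t* *m rho *m v) 0 0.

(* If [s = |rho v|^2] were positive, the form would take the value
   [2 t s + q] at [t v + rho v], which is negative for small real [t]. *)
Lemma positive_form_eq0 (v : 'cV[C]_N) :
  (v^t* *m rho *m v) 0 0 = 0 -> rho *m v = 0.
Proof.
move=> v0; set w := rho *m v.
pose s := (w^t* *m w) 0 0; pose q := (w^t* *m rho *m w) 0 0.
have s_ge0 : 0 <= s by apply: adjmxMl_diag_ge0.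
have q_ge0 : 0 <= q by apply: rho_ge0.
suff s0 : s = 0 by apply: adjmxMl_eq0 => j; rewrite ord1.
apply/eqP; case: eqP => // /eqP s_neq0.
have s_gt0 : 0 < s by rewrite lt0r s_neq0.
(* The solution of [2 t s + q = -1]. *)
pose t : C := - ((q + 1) / (2 * s)).
have t_conj : t^* = t.
  by apply: CrealP; rewrite rpredN rpred_div ?rpredM ?rpredD ?ger0_real.
have := rho_ge0 (t *: v + w).
have -> : (t *: v + w)^t* = t *: v^t* + w^t*.
  by apply/matrixP=> i j; rewrite !mxE rmorphD rmorphM /= t_conj.
have wE : v^t* *m rho = w^t* by rewrite adjmxM rho_adj.
have wv0 : w^t* *m v = 0.
  by apply/matrixP=> i j; rewrite !ord1 -wE v0 mxE.
have wrv : w^t* *m rho *m v = w^t* *m w by rewrite -mulmxA.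
rewrite mulmxDl -scalemxAl wE mulmxDr !mulmxDl -!scalemxAr -!scalemxAl.
rewrite wv0 wrv !scaler0 add0r.
rewrite mxE [X in _ + X]mxE ![fun_of_matrix (t *: _) _ _]mxE -/s -/q.
have -> : t * s + (t * s + q) = -1 by rewrite /t; field; exact: s_neq0.
by rewrite oppr_ge0 ler10.
Qed.

(** With [Q = 1 - T], the diagonal entries of [Q^t* rho Q] are values of the positive form at the
    columns of [Q], and they sum to [tr rho - tr (rho T) = 0]. Each one vanishes, so [rho] kills
    every column of [Q]. *)
Lemma positive_trace_projector (T : 'M[C]_N) :
  T *m T = T -> T^t* = T -> \tr (rho *m T) = \tr rho -> rho *m T = rho.
Proof.
move=> TT T_adj tr_eq; pose Q := 1%:M - T.
have Q_adj : Q^t* = Q by rewrite linearB /= map_mxB T_adj trmx1 map_mx1.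
have QQ : Q *m Q = Q by rewrite mulmxBr mulmx1 mulmxBl mul1mx TT subrr subr0.
have trQ : \tr (Q^t* *m rho *m Q) = 0.
  rewrite mxtrace_mulC mulmxA Q_adj QQ mxtrace_mulC mulmxBr mulmx1.
  by rewrite linearB /= tr_eq subrr.
have diagE j : (Q^t* *m rho *m Q) j j = ((col j Q)^t* *m rho *m col j Q) 0 0.
  have -> : (col j Q)^t* = row j (Q^t*) by apply/matrixP=> k l; rewrite !mxE.
  by rewrite -row_mul !mxE; apply: eq_bigr => k _; rewrite !mxE.
have rhoQ0 : rho *m Q = 0.
  apply/matrixP=> i j; rewrite [RHS]mxE.
  have -> : (rho *m Q) i j = (rho *m col j Q) i 0.
    by rewrite colE mulmxA -colE [RHS]mxE.
  rewrite (_ : rho *m col j Q = 0) ?mxE //; apply: positive_form_eq0.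
  rewrite -diagE.
  move: trQ => /eqP; rewrite psumr_eq0 => [|k _]; last by rewrite diagE.
  by move=> /allP/(_ j (mem_index_enum _)) /eqP.
by apply/esym/eqP; rewrite -subr_eq0 -{1}(mulmx1 rho) -mulmxBr rhoQ0.
Qed.

End Positive.
End Adjoint.

(** * Sandwiches of rank-one matrices and of projectors *)

(** In the rank factorization [P = X Y], the inner factor [Y A X] is a 1 by 1 matrix, hence a
    scalar. *)
Lemma rank1_sandwich (F : fieldType) d (P A : 'M[F]_d) :
  \rank P = 1%N -> exists c, P *m A *m P = c *: P.
Proof.
move=> rP1.
have [c cE] : exists c : F, row_base P *m A *m col_base P = c%:M.
  move: (row_base P *m A *m col_base P); rewrite rP1 => M.
  by exists (M 0 0); rewrite -mx11_scalar.
exists c; rewrite -[in LHS](mulmx_base P).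
set X := col_base P; set Y := row_base P.
have -> : X *m Y *m A *m (X *m Y) = X *m (Y *m A *m X) *m Y.
  by rewrite !mulmxA.
by rewrite cE mul_mx_scalar -scalemxAl mulmx_base.
Qed.

Section Projectors.
Variables (C : numClosedFieldType) (d : nat) (P Q : 'M[C]_d).
Hypotheses (PP : P *m P = P) (QQ : Q *m Q = Q).
Hypotheses (P_adj : P^t* = P) (Q_adj : Q^t* = Q).

(** Expanding [(P - P Q) (P - Q P)] gives [P - P Q P = 0], and the second factor is the adjoint of
    the first. *)
Lemma projector_sandwich : P *m Q *m P = P -> P *m Q = P.
Proof.
move=> PQP; pose D := (P - P *m Q)^t*.
have D_eq : D = P - Q *m P.
  by rewrite /D linearB /= map_mxB adjmxM P_adj Q_adj.
suff : D = 0.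
  move=> D0; apply/esym/eqP; rewrite -subr_eq0 -(adjmxK (P - _)) -/D D0.
  by rewrite trmx0 map_mx0.
apply: adjmxMl_eq0 => j; rewrite adjmxK D_eq mulmxBl !mulmxBr PP mulmxA PQP.
by rewrite -!mulmxA (mulmxA Q Q) QQ (mulmxA P) PQP !subrr mxE.
Qed.

End Projectors.

Lemma projector_inj_sandwich (C : numClosedFieldType) d (P Q : 'M[C]_d) :
  P *m P = P -> Q *m Q = Q -> P^t* = P -> Q^t* = Q ->
  P *m Q *m P = P -> Q *m P *m Q = Q -> P = Q.
Proof.
move=> PP QQ Pa Qa PQP QPQ.
have PQ : P *m Q = P by apply: projector_sandwich.
have QP : Q *m P = Q by apply: projector_sandwich.
by rewrite -[LHS]Pa -PQ adjmxM Pa Qa QP.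
Qed.

(** * Tensor products of local operators *)

Section Tensor.
Variables (R : rcfType) (n d : nat).
Implicit Types A B : 'I_n -> 'M[R[i]]_d.

Lemma eq_tensor A B : A =1 B -> tensor A = tensor B.
Proof.
move=> AB; apply/matrixP=> u v; rewrite !mxE.
by apply: eq_bigr => i _; rewrite AB.
Qed.

Lemma tensorM A B : tensor A *m tensor B = tensor (fun i => A i *m B i).
Proof.
apply/matrixP=> u v; rewrite !mxE.
under [RHS]eq_bigr => i _ do rewrite mxE.
(* Expanding a product of sums gives a sum over functions, which are the strings indexing the
   product basis. *)
rewrite bigA_distr_bigA (reindex (@basis_index n d)) /=; last first.
  exact/onW_bij/enum_rank_bij.
apply: eq_bigr => f _; rewrite !mxE -big_split.
by apply: eq_bigr => i _; rewrite /basis_string enum_rankK.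
Qed.

Lemma tensor_adj A : (tensor A)^t* = tensor (fun i => (A i)^t*).
Proof.
apply/matrixP=> u v; rewrite !mxE rmorph_prod.
by apply: eq_bigr => i _; rewrite !mxE.
Qed.

Lemma tensor_scale1 A B (c : R[i]) j :
  A j = c *: B j -> (forall i, i != j -> A i = B i) -> tensor A = c *: tensor B.
Proof.
move=> Aj Ai; apply/matrixP=> u v; rewrite !mxE (bigD1 j) //= Aj mxE -mulrA.
rewrite [in RHS](bigD1 j) //=; congr (_ * (_ * _)).
by apply: eq_bigr => i /Ai ->.
Qed.

Lemma tensor_eq0 A j : A j = 0 -> tensor A = 0.
Proof. by move=> Aj; rewrite (@tensor_scale1 A A 0 j) ?scale0r ?Aj. Qed.

Lemma projector_tensor A : (forall i, projector (A i)) -> projector (tensor A).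
Proof.
move=> prA; split; rewrite ?tensorM ?tensor_adj;
  by apply: eq_tensor => i; case: (prA i).
Qed.

End Tensor.

Lemma projector_compl (R : rcfType) d (P : 'M[R[i]]_d) :
  projector P -> projector (1%:M - P).
Proof.
case=> PP Pa; split.
  by rewrite mulmxBr mulmx1 mulmxBl mul1mx PP subrr subr0.
by rewrite linearB /= map_mxB Pa trmx1 map_mx1.
Qed.

(** * Separating active from inactive tensor factors *)

Section TensorSplit.
Variables (R : rcfType) (n d : nat) (S : {set 'I_n}).

Lemma tensor_splitD (A : 'M[R[i]]_(tdim #|~: S| d)) :
  {morph tensor_split A : B B' / B + B'}.
Proof. by move=> B B'; apply/matrixP=> u v; rewrite !mxE mulrDr. Qed.

Lemma tensor_split0 (A : 'M[R[i]]_(tdim #|~: S| d)) : tensor_split A 0 = 0.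
Proof. by apply/matrixP=> u v; rewrite !mxE mulr0. Qed.

Lemma tensor_splitZ (A : 'M[R[i]]_(tdim #|~: S| d)) c B :
  tensor_split A (c *: B) = c *: tensor_split A B.
Proof. by apply/matrixP=> u v; rewrite !mxE mulrCA. Qed.

Lemma tensor_split_sum (A : 'M[R[i]]_(tdim #|~: S| d)) I r (P : pred I) F :
  tensor_split A (\sum_(i <- r | P i) F i) =
  \sum_(i <- r | P i) tensor_split A (F i).
Proof. exact: (big_morph _ (tensor_splitD A) (tensor_split0 A)). Qed.

Lemma tensor_split_tensor (T : 'I_n -> 'M[R[i]]_d) :
  tensor_split (tensor (fun i : 'I_#|~: S| => T (enum_val i)))
               (tensor (fun i : 'I_#|S| => T (enum_val i))) = tensor T.
Proof.
apply/matrixP=> u v; rewrite !mxE (bigID (mem S)) /= mulrC; congr (_ * _).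
  rewrite [RHS]big_enum_val; apply: eq_bigr => i _.
  by rewrite /basis_string !enum_rankK !ffunE.
under [RHS]eq_bigl => i do rewrite -in_setC.
rewrite [RHS]big_enum_val; apply: eq_bigr => i _.
by rewrite /basis_string !enum_rankK !ffunE.
Qed.

End TensorSplit.

(** * Subset games as Bell functionals with one output fewer *)

Section Relabeling.
Variables (R : rcfType) (n m : nat) (S : {set 'I_n}).
Variables (beta : bell_functional R n m.+1) (adet : det_strategy n m.+1).

(** The map [lift h] enumerates the outputs other than [h]; the relabeling takes for [h] the
    deterministic output of the party at its input. *)
Lemma subset_game_relabeling_lift :
  exists (gamma : bell_functional R #|S| m)
         (tau : 'I_#|S| -> 'Z_2 -> 'I_m -> 'I_m.+1),
    subset_game_relabeling beta adet gamma tau.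
Proof.
pose tau (i : 'I_#|S|) z (l : 'I_m) := lift (adet (enum_val i) z) l.
pose out (l : {ffun 'I_#|S| -> 'I_m}) (xi : {ffun 'I_#|S| -> 'Z_2}) :=
  [ffun i => tau i (xi i) (l i)].
exists (fun l xi => subset_coeff beta adet (out l xi) xi), tau.
split=> [i z|i z b|//|d Pi]; first exact: lift_inj.
  split=> [[l <-]|b_neq]; first by rewrite eq_sym neq_lift.
  by rewrite eq_sym in b_neq; have [l -> _] := unlift_some b_neq; exists l.
apply: eq_bigr => xi _.
have out_inj : injective (out^~ xi).
  move=> l l' /ffunP ll'; apply/ffunP => i.
  by have := ll' i; rewrite !ffunE => /lift_inj.
(* The admissible strings form the image of the injective map [out^~ xi], so the sum can be
   reindexed by the relabeled strings. *)
rewrite (eq_bigl (mem [set out l xi | l in setT])) => [|alpha].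
  rewrite big_imset /= => [|l l' _ _]; last exact: out_inj.
  apply: eq_big => [l|l _]; first by rewrite inE.
  by congr (_ *: _); apply: eq_tensor => i; rewrite ffunE.
apply/forallP/imsetP => [adm|[l _ ->] i]; last first.
  by rewrite ffunE eq_sym neq_lift.
have adm_i i : exists l, tau i (xi i) l = alpha i.
  by have := adm i; rewrite eq_sym => /unlift_some[l -> _]; exists l.
have [l lE] := fin_all_exists adm_i.
by exists (finfun l); rewrite ?inE //; apply/ffunP => i; rewrite !ffunE lE.
Qed.

End Relabeling.

(** * Grouping strings by the set of deviating parties *)

Section Support.
Variables (R : rcfType) (n m : nat) (adet : det_strategy n m.+1).
Implicit Types (a : {ffun 'I_n -> 'I_m.+1}) (x : {ffun 'I_n -> 'Z_2}).

Definition deviation a x : {set 'I_n} := [set i | a i != adet i (x i)].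

Lemma weight_deviation a x : weight (a - det_output adet x) = #|deviation a x|.
Proof. by apply: eq_card => i; rewrite !inE !ffunE subr_eq0. Qed.

Lemma extend_enum_val (S : {set 'I_n}) (alpha : {ffun 'I_#|S| -> 'I_m.+1}) x i :
  extend adet alpha x (enum_val i) = alpha i.
Proof.
by have /ffunP/(_ i) := substring_extend adet alpha x; rewrite ffunE.
Qed.

Lemma deviation_extend (S : {set 'I_n}) alpha x :
  (deviation (extend adet alpha x) x == S) =
  admissible adet alpha (substring S x).
Proof.
apply/eqP/forallP => [devS i|adm].
  have := enum_valP i; rewrite -{2}devS inE extend_enum_val.
  by rewrite [substring _ _ _]ffunE.
apply/setP=> j; rewrite inE; case: (boolP (j \in S)) => [jS|jNS].
  rewrite -(enum_rankK_in jS jS) extend_enum_val.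
  by have := adm (enum_rank_in jS j); rewrite [substring _ _ _]ffunE.
by rewrite extend_out // eqxx.
Qed.

Lemma extend_deviation (S : {set 'I_n}) a x :
  deviation a x = S -> extend adet (substring S a) x = a.
Proof.
move=> devS; apply/ffunP=> j; case: (boolP (j \in S)) => [jS|jNS].
  by rewrite -(enum_rankK_in jS jS) extend_enum_val ffunE.
rewrite extend_out //; move: jNS; rewrite -devS inE negbK.
by move=> /eqP.
Qed.

(** Restriction to [S] and extension by deterministic outputs are mutually inverse on these index
    sets. *)
Lemma sum_deviation (V : nmodType) (S : {set 'I_n}) x
    (F : {ffun 'I_n -> 'I_m.+1} -> V) :
  \sum_(a | deviation a x == S) F a =
  \sum_(alpha | admissible adet alpha (substring S x)) F (extend adet alpha x).
Proof.
rewrite (reindex_onto (fun alpha => extend adet alpha x) (@substring n S _)).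
  apply: eq_bigl => alpha.
  by rewrite deviation_extend substring_extend eqxx andbT.
by move=> a /eqP; apply: extend_deviation.
Qed.

(** Unfolding [subset_coeff] merges the sum over [xi] with the sum over its fiber of inputs [x];
    this matches the outer sum of [B2]. *)
Lemma subset_operator_sum d (beta : bell_functional R n m.+1) (S : {set 'I_n})
    (Pi : local_operators R #|S| m.+1 d) :
  subset_operator S beta adet Pi =
  \sum_x \sum_(alpha | admissible adet alpha (substring S x))
    (beta (extend adet alpha x) x - beta (det_output adet x) x)%:C%C *:
      joint_operator Pi alpha (substring S x).
Proof.
rewrite (partition_big (@substring n S 'Z_2) xpredT) //=.
apply: eq_bigr => xi _.
under [RHS]eq_bigr => x /eqP -> do [].
rewrite [RHS]exchange_big /=; apply: eq_bigr => alpha _.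
by rewrite -scaler_suml -rmorph_sum.
Qed.

End Support.

(** * Consequences of realizing the deterministic correlation *)

Section Sandwich.
Variables (R : rcfType) (n m : nat) (adet : det_strategy n m.+1).
Variable Sigma : projective_strategy R n m.+1.
Hypothesis rank1 : forall i z, \rank (meas Sigma i z (adet i z)) = 1%N.
Hypothesis realized : realizes Sigma (det_correlation R adet).

Let p i z := meas Sigma i z (adet i z).
Let rho := state Sigma.

Let projector_p i z : projector (p i z).
Proof. by have [proj _ _] := meas_projective Sigma i z; apply: proj. Qed.

(** The deterministic output has probability 1, which is also the trace of [rho], so the trace
    criterion applies. *)
Let rho_tensor (x : {ffun 'I_n -> 'Z_2}) :
  rho *m tensor (fun i => p i (x i)) = rho.
Proof.
have [rho_adj rho_ge0 rho_tr] := state_density Sigma.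
have [TT Ta] : projector (tensor (fun i => p i (x i))).
  by apply: projector_tensor => i; apply: projector_p.
apply: positive_trace_projector => //; rewrite rho_tr.
have := realized (det_output adet x) x.
rewrite /det_correlation big1 ?rmorph1 => [<-|i _]; last by rewrite ffunE eqxx.
by congr (\tr (_ *m _)); apply: eq_tensor => i; rewrite ffunE.
Qed.

(* For inputs x and x' that differ only at i, the deterministic projectors
   T x and T x' fix rho and T x *m T x' *m T x = c *: T x, whence c = 1. *)
Let p_sandwich i z z' : p i z *m p i z' *m p i z = p i z.
Proof.
have [c cE] := rank1_sandwich (p i z') (rank1 i z); rewrite -/(p i z) in cE.
pose x : {ffun 'I_n -> 'Z_2} := [ffun=> z].
pose x' : {ffun 'I_n -> 'Z_2} := [ffun j => if j == i then z' else z].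
have : rho = c *: rho.
  rewrite -[LHS](rho_tensor x) -[in LHS](rho_tensor x') -[in LHS](rho_tensor x).
  rewrite -[in RHS](rho_tensor x) scalemxAr -!mulmxA !tensorM.
  congr (_ *m _); apply: (tensor_scale1 (j := i)) => [|j ji].
    by rewrite !ffunE eqxx mulmxA.
  rewrite !ffunE (negPf ji); have [pp _] := projector_p j z.
  by rewrite !pp.
move=> /(congr1 mxtrace); rewrite linearZ /=.
have [_ _ ->] := state_density Sigma; rewrite mulr1 => c1.
by rewrite cE -c1 scale1r.
Qed.

Lemma det_projector_input_independent i z z' :
  meas Sigma i z (adet i z) = meas Sigma i z' (adet i z').
Proof.
have [[pp pa] [pp' pa']] := (projector_p i z, projector_p i z').
by apply: projector_inj_sandwich => //; apply: p_sandwich.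
Qed.

End Sandwich.

(** * The sum over subsets and its orthogonality *)

Section Decomposition.
Variables (R : rcfType) (n m d : nat) (beta : bell_functional R n m.+1).
Variables (adet : det_strategy n m.+1) (Pi : local_operators R n m.+1 d).
Hypothesis Pi_meas : forall i z, projective_measurement (Pi i z).
Hypothesis Pi_det : forall i z, Pi i z (adet i z) = Pi i 0 (adet i 0).

Let summand S := tensor_split (inactive_projector S adet Pi)
                   (subset_operator S beta adet (restrict_parties S Pi)).

Let coeff a x : R[i] := (beta a x - beta (det_output adet x) x)%:C%C.

(** Inactive parties give their deterministic outputs, so [Pi_det] lets their inputs [x j] be
    replaced by 0, uniformly in [x]. *)
Let summandE S :
  summand S =
  \sum_x \sum_(a | deviation adet a x == S) coeff a x *: joint_operator Pi a x.
Proof.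
rewrite /summand subset_operator_sum tensor_split_sum.
apply: eq_bigr => x _; rewrite tensor_split_sum sum_deviation.
apply: eq_bigr => alpha _; rewrite tensor_splitZ; congr (_ *: _).
rewrite -[RHS](tensor_split_tensor S); congr tensor_split;
  apply: eq_tensor => i.
  rewrite extend_out -?in_setC ?enum_valP //; exact/esym/Pi_det.
by rewrite extend_enum_val ffunE.
Qed.

(** The weight is the size of the deviation set, so partitioning by that set leaves exactly the
    subsets of size at least 2. *)
Lemma B2_sum_subsets :
  B2 beta adet Pi = \sum_(S : {set _} | (2 <= #|S|)%N) summand S.
Proof.
under [RHS]eq_bigr => S _ do rewrite summandE.
rewrite [RHS]exchange_big; apply: eq_bigr => x _.
rewrite (partition_big (deviation adet ^~ x) (fun S : {set _} => 2 <= #|S|)%N) => [|a].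
  apply: eq_bigr => S S2; apply: eq_bigl => a.
  by rewrite weight_deviation; case: eqP => [->|]; rewrite ?S2 ?andbF.
by rewrite weight_deviation.
Qed.

(** The factor at party [i] of the projector onto the subspace of [S]. *)
Let local_block (S : {set 'I_n}) i : 'M[R[i]]_d :=
  if i \in S then 1%:M - Pi i 0 (adet i 0) else Pi i 0 (adet i 0).

Let projector_det i : projector (Pi i 0 (adet i 0)).
Proof. by have [proj _ _] := Pi_meas i 0; apply: proj. Qed.

Let projector_local_block S i : projector (local_block S i).
Proof.
by rewrite /local_block; case: ifP => // _; apply: projector_compl.
Qed.

(** At a deviating party the measured projector is orthogonal to the deterministic one, so the
    complement of the latter fixes it; elsewhere the two coincide. *)
Let block_joint a x (S := deviation adet a x) :
  tensor (local_block S) *m joint_operator Pi a x = joint_operator Pi a x /\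
  joint_operator Pi a x *m tensor (local_block S) = joint_operator Pi a x.
Proof.
suff local i : local_block S i *m Pi i (x i) (a i) = Pi i (x i) (a i) /\
               Pi i (x i) (a i) *m local_block S i = Pi i (x i) (a i).
  by rewrite !tensorM; split; apply: eq_tensor => i; case: (local i).
have [proj orth _] := Pi_meas i (x i).
rewrite /local_block -(Pi_det i (x i)) inE; case: eqP => [->|/eqP a_neq] /=.
  by have [] := proj (adet i (x i)).
by rewrite mulmxBl mulmxBr mul1mx mulmx1 !orth ?subr0 // eq_sym.
Qed.

Lemma direct_sum_B2 :
  direct_sum_decomposition (fun S : {set 'I_n} => (2 <= #|S|)%N)
    (B2 beta adet Pi) summand.
Proof.
split; first exact: B2_sum_subsets.
exists (fun S => tensor (local_block S)); split=> [S _|S S' _ _ neqSS'|S _].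
- by apply: projector_tensor.
(* At a party where the two sets differ, the factors are complementary projectors, with product
   0. *)
- have [i Si] : exists i, (i \in S) != (i \in S').
    apply/existsP; apply: contraR neqSS' => /existsPn SS'.
    by apply/eqP/setP => i; apply/eqP; rewrite -[_ == _]negbK SS'.
  rewrite tensorM (tensor_eq0 (j := i)) // /local_block.
  have [pp _] := projector_det i.
  case: (i \in S) Si => [|]; case: (i \in S') => //= _.
    by rewrite mulmxBl mul1mx pp subrr.
  by rewrite mulmxBr mulmx1 pp subrr.
- rewrite summandE mulmx_sumr mulmx_suml; apply: eq_bigr => x _.
  rewrite mulmx_sumr mulmx_suml; apply: eq_bigr => a /eqP <-.
  have [bJ Jb] := block_joint a x.
  by rewrite -scalemxAr -scalemxAl bJ Jb.
Qed.

End Decomposition.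

(* d = m.+1.  The d-outcome projective measurements on C^d are nondegenerate
   (rank-one projectors); only the projectors onto the outcomes of the
   deterministic strategy need this, and it is assumed only for them. *)
Theorem lemma5 (R : rcfType) (n m : nat) (beta : bell_functional R n m.+1)
    (adet : det_strategy n m.+1) :
  (forall S : {set 'I_n},
     exists (gamma : bell_functional R #|S| m)
            (tau : 'I_#|S| -> 'Z_2 -> 'I_m -> 'I_m.+1),
       subset_game_relabeling beta adet gamma tau) /\
  (forall Sigma : projective_strategy R n m.+1,
     (forall i z, \rank (meas Sigma i z (adet i z)) = 1%N) ->
     realizes Sigma (det_correlation R adet) ->
     direct_sum_decomposition (fun S : {set 'I_n} => (2 <= #|S|)%N)
       (B2 beta adet (meas Sigma))
       (fun S => tensor_split (inactive_projector S adet (meas Sigma))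
                   (subset_operator S beta adet
                      (restrict_parties S (meas Sigma))))).
Proof.
split=> [S|Sigma rank1 realized]; first exact: subset_game_relabeling_lift.
apply: direct_sum_B2 => i z; first exact: meas_projective.
exact: det_projector_input_independent.
Qed.
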